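(* Let $\mathcal{A}$ be a prime PI algebra over a field $\mathbb{F}$, endowed with an involution of the second kind, and let $\mathcal{L}$ be a Lie skew-ideal of $\mathcal{A}$. If $\operatorname{char}(\mathbb{F})\neq 2$, then $\widetilde{\mathcal{L}}$ is either $0$, $\widetilde{\mathcal{Z}}$, $[\widetilde{\mathcal{A}},\widetilde{\mathcal{A}}]$ or $\widetilde{\mathcal{A}}$.
   Context: Algebras are associative, not necessarily unital. An algebra is prime if the product of any two of its nonzero ideals is nonzero; it is PI if it satisfies a nonzero polynomial identity from the free algebra $\mathbb{F}\langle X_1,X_2,\ldots\rangle$. An involution $*$ on $\mathcal{A}$ is an additive map with $(ab)^*=b^*a^*$, $a^{**}=a$ (compatible with scalars via an involution of $\mathbb{F}$, possibly trivial: $(\lambda a)^*=\lambda^*a^*$); it is of the second kind if it does not fix the center $\mathcal{Z}$ of $\mathcal{A}$ pointwise. $\mathcal{K}=\{a\in\mathcal{A}:a^*=-a\}$. A Lie skew-ideal of $\mathcal{A}$ is an $\mathbb{F}$-linear subspace $\mathcal{L}$ with $[\ell,k]=\ell k-k\ell\in\mathcal{L}$ for all $\ell\in\mathcal{L}$, $k\in\mathcal{K}$. For a prime PI algebra $\mathcal{A}$ the center $\mathcal{Z}$ is nonzero; $\widetilde{\mathcal{Z}}$ denotes its field of fractions, and the central closure $\widetilde{\mathcal{A}}$ is the central localization consisting of elements $z^{-1}a$ ($a\in\mathcal{A}$, $0\neq z\in\mathcal{Z}$), which is a finite dimensional central simple algebra over $\widetilde{\mathcal{Z}}$. For a subset $\mathcal{V}\subseteq\mathcal{A}$,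 $\widetilde{\mathcal{V}}$ denotes the $\widetilde{\mathcal{Z}}$-linear span of $\mathcal{V}$ in $\widetilde{\mathcal{A}}$. $[\widetilde{\mathcal{A}},\widetilde{\mathcal{A}}]$ is the linear span of all commutators in $\widetilde{\mathcal{A}}$. *)

(* Defs.v *)
From HB Require Import structures.
From mathcomp Require Import all_boot all_order all_algebra.
From mathcomp Require Import finmap monalg.
From mathcomp Require Import boolp classical_sets.

Set Implicit Arguments.
Unset Strict Implicit.
Unset Printing Implicit Defensive.

Import GRing.Theory.
Local Open Scope ring_scope.
Local Open Scope classical_set_scope.

(* MathComp's algebras are all unital, hence a structure for associative
   algebras that may lack a unit. *)
HB.mixin Record Lmodule_isAssocAlgebra (F : fieldType) A
    of GRing.Lmodule F A := {
  amul : A -> A -> A;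
  amulA : associative amul;
  amulDl : left_distributive amul +%R;
  amulDr : right_distributive amul +%R;
  amulZl : forall (c : F) (a b : A), amul (c *: a) b = c *: amul a b;
  amulZr : forall (c : F) (a b : A), amul a (c *: b) = c *: amul a b
}.

#[short(type="assocAlgType")]
HB.structure Definition AssocAlgebra (F : fieldType) :=
  {A of Lmodule_isAssocAlgebra F A & GRing.Lmodule F A}.

Notation "a ** b" := (amul a b) (at level 40, left associativity) : ring_scope.

Definition subspace (K : fieldType) (V : lmodType K) (S : set V) : Prop :=
  [/\ S 0, forall u v, S u -> S v -> S (u + v)
    & forall (c : K) v, S v -> S (c *: v)].

Definition lspan (K : fieldType) (V : lmodType K) (S : set V) : set V :=
  [set v | exists n (c : 'I_n -> K) (u : 'I_n -> V),
     (forall i, S (u i)) /\ v = \sum_(i < n) c i *: u i].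

Section Algebras.
Variables (F : fieldType) (A : assocAlgType F).

Definition ideal (I : set A) : Prop :=
  subspace I /\ forall a b, I b -> I (a ** b) /\ I (b ** a).

Definition ideal_prod (I J : set A) : set A :=
  lspan [set c | exists a b, [/\ I a, J b & c = a ** b]].

Definition prime_alg : Prop :=
  forall I J : set A, ideal I -> ideal J ->
    I <> [set 0] -> J <> [set 0] -> ideal_prod I J <> [set 0].

(* The value on the empty word is junk: only polynomials without constant term
   are ever evaluated in a possibly non-unital algebra. *)
Definition word_eval (x : nat -> A) (w : seq nat) : A :=
  if w is i :: s then foldl (fun a j => a ** x j) (x i) s else 0.

Definition ncpoly_eval (x : nat -> A) (f : {malg F[{fmonom nat}]}) : A :=
  \sum_(w <- msupp f) f@_w *: word_eval x w.

Definition PI_alg : Prop :=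
  exists f : {malg F[{fmonom nat}]},
    [/\ f != 0, f@_(mone : {fmonom nat}) = 0
      & forall x : nat -> A, ncpoly_eval x f = 0].

Definition acenter : set A := [set z | forall a, z ** a = a ** z].

Record involution_alg (sigma : {rmorphism F -> F}) (star : A -> A) : Prop := {
  star_scalK : involutive sigma;
  starD : {morph star : a b / a + b};
  starM : forall a b, star (a ** b) = star b ** star a;
  starK : involutive star;
  starZ : forall (c : F) a, star (c *: a) = sigma c *: star a
}.

Definition second_kind (star : A -> A) : Prop :=
  exists2 z, acenter z & star z <> z.

Definition skew_elements (star : A -> A) : set A := [set a | star a = - a].

Definition lie_skew_ideal (star : A -> A) (L : set A) : Prop :=
  subspace L /\
  forall l k, L l -> skew_elements star k -> L (l ** k - k ** l).

End Algebras.

(* The pair (K, Q) is, through phi : A -> Q, the field of fractions of the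
   center Z of A and the localization of A at the nonzero elements of Z.  The
   field K sits in Q as the scalars c%:A; Z goes into it by cc_center, every
   c in K is a fraction w / z by cc_frac, and every q in Q is some z^-1 a by
   cc_loc.  These conditions determine (K, Q, phi) up to unique isomorphism. *)
Record central_closure (F : fieldType) (A : assocAlgType F)
    (K : fieldType) (Q : algType K) (phi : {additive A -> Q}) : Prop := {
  cc_inj : injective phi;
  cc_mul : forall a b, phi (a ** b) = phi a * phi b;
  cc_center : forall z, acenter z -> exists c : K, phi z = c%:A;
  cc_frac : forall c : K, exists z w,
    [/\ acenter z, z <> 0, acenter w & c *: phi z = phi w];
  cc_loc : forall q : Q, exists z a,
    [/\ acenter z, z <> 0 & phi z * q = phi a]
}.

Definition closure_span (F : fieldType) (A : assocAlgType F)
    (K : fieldType) (Q : algType K) (phi : A -> Q) (V : set A) : set Q :=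
  lspan (phi @` V).

Section Closure.
Variables (K : fieldType) (Q : algType K).

Definition scalars : set Q := range (fun c : K => c%:A).

Definition commutator_span : set Q :=
  lspan [set c | exists a b : Q, c = a * b - b * a].

End Closure.

Arguments scalars {K} Q.
Arguments commutator_span {K} Q.

(* Main.v *)
Require Import Defs.
From HB Require Import structures.
From mathcomp Require Import all_boot all_order all_algebra.
From mathcomp Require Import finmap monalg.
From mathcomp Require Import boolp classical_sets.

Set Implicit Arguments.
Unset Strict Implicit.
Unset Printing Implicit Defensive.

Import GRing.Theory.
Local Open Scope ring_scope.

(** Write L~ for the K-span of L in the central closure Q.

    The second kind gives a nonzero central element s with s^* = -s.  If h is
    symmetric then s h is skew, and [l, s h] = s [l, h]; since s is invertible
    in Q, L~ is closed under brackets with symmetric elements as well as with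
    skew ones.  As 2 is invertible, L~ is a Lie ideal of Q
    ([closure_lie_ideal]).  By Herstein's theorem a Lie ideal of the central
    simple algebra Q lies in the centre K or contains [Q, Q]
    ([lie_ideal_dichotomy]); as [Q, Q] has codimension at most one
    ([commutator_codim1]), only the four listed spaces remain.

    The substance is that Q is simple and that [Q, Q] has codimension at most
    one, given only that Q is prime, has centre K and satisfies a polynomial
    identity.  Both follow from one object: a nonzero elementary operator
    tau(v) = sum_i h_i v g_i with values in K ([identity_central]).  Any nonzero
    ideal is carried by tau onto K, so it contains 1.  The transpose
    T(x) = sum_i g_i x h_i kills commutators, and tau(v) x = v T(x) modulo
    [Q, Q], so ker T = [Q, Q]; finally T has rank one because
    T(v T(x)) = tau(v) T(x) and Q is simple.  (In matrices tau(v) = tr(e v) 1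
    and T(x) = tr(x) e.)

    To find tau without the extended centroid, everything is expressed by
    elementary operators and the following transposition principle
    ([mulop_transpose_eq0]): in a prime ring, if sum_i a_i x b_i = 0 for all x,
    then sum_i b_i x a_i = 0 for all x.  A multilinear identity of Q in which x
    and z occur in both relative orders says that a nonzero
    A(x, z) = sum_l alpha_l(x) z beta_l equals sum_k a_k z b_k(x) with a_k
    independent of x ([identity_bimulop]).  Eliminating all but one of the a_k
    and of the beta_l leaves A(x, z) = mu(x) a z b with mu(x) a scalar of the
    extended centroid, hence an operator of rank one
    ([bimulop_isolate_left], [bimulop_isolate_right], [isolated_rank_one]).
    If p is a value of such an operator R, then substituting elements of Q p Q
    in an identity gives y e = - sum_k a'_k p a''_k y b_k for all y, with e
    nonzero ([identity_pideal]): over the extended centroid, 1 is in the ideal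
    generated by p.  Replacing p by R(v b_k w) in sum_k a'_k p a''_k yields tau
    ([rank_one_central]). *)

(** * Elementary operators on prime rings *)

Section PrimeRing.
Variable R : nzRingType.
Implicit Types (s : seq (R * R)) (a b x y z v w : R).

Definition prime_ring := forall a b, (forall x, a * x * b = 0) -> a = 0 \/ b = 0.

Definition mulop s x : R := \sum_(p <- s) p.1 * x * p.2.
Definition mulopT s x : R := \sum_(p <- s) p.2 * x * p.1.

Lemma mulopT_is_additive s : {morph mulopT s : x y / x - y}.
Proof.
move=> x y; rewrite /mulopT -sumrB; apply: eq_bigr => p _.
by rewrite mulrBr mulrBl.
Qed.
HB.instance Definition _ s := GRing.isZmodMorphism.Build R R (mulopT s) (mulopT_is_additive s).

Hypothesis Rprime : prime_ring.

(** Over the extended centroid C the hypothesis says that sum_i a_i (x) b_i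
    vanishes in the tensor square over C.  The direct proof: eliminating one
    term gives, by induction, b_j y S(v) = S(y b_j v) for the transpose S, and
    then S(v) x S(v) = S(v (sum_i a_i x b_i) v) = 0. *)
Lemma mulop_transpose_eq0 s :
  (forall x, mulop s x = 0) -> forall x, mulopT s x = 0.
Proof.
have [n] := ubnP (size s); elim: n s => // n IHn s; rewrite ltnS => les s0.
have slide q y v : q \in s -> q.2 * y * mulopT s v = mulopT s (y * q.2 * v).
  move=> qs; pose s' := [seq (p.1, q.2 * y * p.2 - p.2 * y * q.2) | p <- rem q s].
  have perm_s := perm_to_rem qs.
  (* The term of q itself would be zero in s', so s' is one term shorter than s. *)
  have s'0 x : mulop s' x = 0.
    have: mulop s (x * q.2 * y) - mulop s x * y * q.2 = 0 by rewrite !s0 !mul0r subr0.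
    rewrite /mulop !(perm_big _ perm_s) /= !big_cons !mulrDl.
    rewrite opprD addrACA !mulrA subrr add0r => E; rewrite -[RHS]E.
    rewrite /s' big_map !mulr_suml -sumrB; apply: eq_bigr => p _ /=.
    by rewrite mulrBr !mulrA.
  have lt_s' : (size s' < n)%N.
    rewrite size_map size_rem //; case: (s) qs les => //=.
  have := IHn s' lt_s' s'0 v.
  rewrite /mulopT /s' big_map /= => s'v.
  apply/eqP; rewrite -subr_eq0; apply/eqP; rewrite -[RHS]s'v.
  rewrite !(perm_big _ perm_s) /= !big_cons mulrDr opprD addrACA !mulrA subrr add0r.
  rewrite mulr_sumr -sumrB; apply: eq_bigr => p _ /=.
  by rewrite !mulrBl !mulrA.
move=> v; suff: forall x, mulopT s v * x * mulopT s v = 0 by case/Rprime.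
move=> x; rewrite {1}/mulopT !mulr_suml.
transitivity (\sum_(p <- s) mulopT s (v * p.1 * x * p.2 * v)).
  apply: eq_big_seq => p ps; rewrite -slide //.
  by rewrite !mulrA.
rewrite -raddf_sum -mulr_suml.
have -> : \sum_(i <- s) v * i.1 * x * i.2 = v * mulop s x.
  by rewrite mulr_sumr; apply: eq_bigr => p _; rewrite !mulrA.
by rewrite s0 mulr0 mul0r raddf0.
Qed.

Lemma mulopT_transpose_eq0 s :
  (forall x, mulopT s x = 0) -> forall x, mulop s x = 0.
Proof.
move=> s0 x; have := @mulop_transpose_eq0 [seq (q.2, q.1) | q <- s] _ x.
rewrite /mulopT big_map; apply=> y.
by have := s0 y; rewrite /mulop /mulopT big_map.
Qed.

Lemma mulop_transpose_eq s s' :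
  mulop s =1 mulop s' -> mulopT s =1 mulopT s'.
Proof.
move=> ss' x; pose t := s ++ [seq (- p.1, p.2) | p <- s'].
have t0 y : mulop t y = 0.
  rewrite /mulop big_cat big_map /=.
  under [X in _ + X]eq_bigr do rewrite !mulNr.
  by rewrite sumrN -/(mulop s y) ss' subrr.
have := mulop_transpose_eq0 t0 x.
rewrite /mulopT big_cat big_map /=.
under [X in _ + X]eq_bigr do rewrite mulrN.
by rewrite sumrN => /subr0_eq.
Qed.

Lemma sandwich_transpose a b a' b' :
  (forall x, a * x * b = a' * x * b') -> forall x, b * x * a = b' * x * a'.
Proof.
move=> ab x; have := @mulop_transpose_eq [:: (a, b)] [:: (a', b')].
rewrite /mulop /mulopT => H; have := H _ x; rewrite !big_seq1; apply.
by move=> y; rewrite !big_seq1 ab.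
Qed.

(** These are the operators bilinear in (x, z) where x always stands to the
    left of z. *)
Definition bimulop (L : seq (seq (R * R) * R)) x z : R :=
  \sum_(p <- L) mulop p.1 x * z * p.2.

(** For an elementary f this says that its values span at most a line over the
    extended centroid. *)
Definition rank_one (f : R -> R) :=
  forall x x' y, f x * y * f x' = f x' * y * f x.

Definition bracketl c y s :=
  [seq (c * y * p.1, p.2) | p <- s] ++ [seq (- p.1, p.2 * y * c) | p <- s].

Lemma mulop_bracketl c y s x :
  mulop (bracketl c y s) x = c * y * mulop s x - mulop s x * y * c.
Proof.
rewrite /mulop big_cat !big_map /= mulr_sumr !mulr_suml -sumrN.
by congr (_ + _); apply: eq_bigr => p _; rewrite ?mulNr !mulrA.
Qed.

Definition nonzero2 (A : R -> R -> R) := exists x z, A x z <> 0.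

(** The map u (x) w |-> (a y u - u y a) (x) w kills the left factor a, so it
    shortens the list of the a_k; the elimination stops at the first a that
    cannot be removed without losing A. *)
Lemma bimulop_isolate_left L (as_ : seq R) :
  nonzero2 (bimulop L) ->
  (forall x, exists2 s, [seq p.1 | p <- s] = as_ & bimulop L x =1 mulop s) ->
  exists L' a, [/\ nonzero2 (bimulop L'), a <> 0 &
    forall x y z, a * y * bimulop L' x z = bimulop L' x (y * a * z)].
Proof.
have [n] := ubnP (size as_); elim: n as_ L => // n IHn [|a as_] L /=;
  rewrite ?ltnS => lt_as nzA finA.
  case: nzA => x [z []]; have [[|//] _ ->] := finA x.
  by rewrite /mulop big_nil.
have [a0|/eqP nza] := eqVneq a 0.
  apply: (IHn as_ L) => // x; have [[|[a' b] s] //= [a'a sas] As] := finA x.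
  by exists s => // z; rewrite As /mulop big_cons /= a'a a0 !mul0r add0r.
have [slide|/existsNP[y /existsNP[x /existsNP[z nzy]]]] := pselect (forall y x z,
    a * y * bimulop L x z - bimulop L x (y * a * z) = 0).
  by exists L, a; split=> // x y z; apply/subr0_eq/slide.
pose L' := [seq (bracketl a y p.1, p.2) | p <- L].
have L'E x' z' : bimulop L' x' z' = a * y * bimulop L x' z' - bimulop L x' (y * a * z').
  rewrite /bimulop big_map mulr_sumr -sumrB; apply: eq_bigr => p _ /=.
  by rewrite mulop_bracketl !mulrBl !mulrA.
apply: (IHn [seq a * y * c - c * y * a | c <- as_] L').
- by rewrite size_map.
- by exists x, z; rewrite L'E.
move=> x'; have [[|[a' b] s] //= [a'a sas] As] := finA x'.
exists [seq (a * y * p.1 - p.1 * y * a, p.2) | p <- s].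
  by rewrite -sas -!map_comp.
move=> z'; rewrite L'E !As /mulop !big_cons big_map /= a'a mulrDr opprD addrACA.
rewrite !mulrA subrr add0r mulr_sumr -sumrB; apply: eq_bigr => p _.
by rewrite !mulrBl !mulrA.
Qed.

(** The same elimination on the right factors beta_l; it respects the relation
    already obtained on the left. *)
Lemma bimulop_isolate_right L a :
  nonzero2 (bimulop L) ->
  (forall x y z, a * y * bimulop L x z = bimulop L x (y * a * z)) ->
  exists L' b, [/\ nonzero2 (bimulop L'), b <> 0,
    forall x y z, a * y * bimulop L' x z = bimulop L' x (y * a * z) &
    forall x y z, bimulop L' x z * y * b = bimulop L' x (z * b * y)].
Proof.
have [n] := ubnP (size L); elim: n L => // n IHn [|[s b] L] /=.
  by move=> _ [x [z]]; rewrite /bimulop big_nil.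
rewrite ltnS => ltLn nzA slideA; set A := bimulop _ in nzA slideA.
have [b0|/eqP nzb] := eqVneq b 0.
  have AE x z : A x z = bimulop L x z.
    by rewrite /A /bimulop big_cons /= b0 mulr0 add0r.
  apply: (IHn L) => //; first by case: nzA => x [z Axz]; exists x, z; rewrite -AE.
  by move=> x y z; rewrite -!AE.
have [slide|/existsNP[y /existsNP[x /existsNP[z nzy]]]] := pselect (forall y x z,
    A x z * y * b - A x (z * b * y) = 0).
  by exists ((s, b) :: L), b; split=> // x y z; apply/subr0_eq/slide.
pose L' := [seq (p.1, p.2 * y * b - b * y * p.2) | p <- L].
have L'E x' z' : bimulop L' x' z' = A x' z' * y * b - A x' (z' * b * y).
  rewrite /A /bimulop !big_cons /= !mulrDl opprD addrACA !mulrA subrr add0r.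
  rewrite big_map !mulr_suml -sumrB; apply: eq_bigr => p _ /=.
  by rewrite mulrBr !mulrA.
apply: (IHn L'); first by rewrite size_map.
  by exists x, z; rewrite L'E.
by move=> x' y' z'; rewrite !L'E mulrBr !mulrA !slideA !mulrA.
Qed.

(** The two relations express A(x, z) = mu(x) a z b with mu(x) in the extended
    centroid.  Transposition turns them into A(x, z) y a w b = a z b y A(x, w)
    ([move_blank] in the proof): the scalar mu(x) may be moved to any other
    occurrence of a . b.  A product with three slots, filled by mu(x), mu(x')
    and a blank, can be rotated by transposition; rotations and moves of the
    blank together exchange x and x'. *)
Lemma isolated_rank_one L a b z :
  a <> 0 -> b <> 0 ->
  (forall x y z, a * y * bimulop L x z = bimulop L x (y * a * z)) ->
  (forall x y z, bimulop L x z * y * b = bimulop L x (z * b * y)) ->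
  rank_one (bimulop L ^~ z).
Proof.
move=> nza nzb slidea slideb; set A := bimulop L.
pose S x z := \sum_(p <- L) p.2 * z * mulop p.1 x.
have AS x z1 y : A x z1 * y * a = a * z1 * S x y.
  pose s := [seq (a, mulop p.1 x * z1 * p.2) | p <- L].
  pose s' := [seq (mulop p.1 x, a * z1 * p.2) | p <- L].
  have := @mulop_transpose_eq s s'; rewrite /mulop /mulopT => H.
  have := H _ y; rewrite !big_map /= -!mulr_suml mulr_sumr => -> //.
    by apply: eq_bigr => p _; rewrite !mulrA.
  move=> t; rewrite !big_map /= -mulr_sumr slidea; apply: eq_bigr => p _ /=.
  by rewrite !mulrA.
have SA x z1 y : b * y * A x z1 = S x y * z1 * b.
  pose s := [seq (mulop p.1 x * z1 * p.2, b) | p <- L].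
  pose s' := [seq (mulop p.1 x * z1 * b, p.2) | p <- L].
  have := @mulop_transpose_eq s s'; rewrite /mulop /mulopT => H.
  have := H _ y; rewrite !big_map /= -mulr_sumr => -> //.
    by rewrite !mulr_suml; apply: eq_bigr => p _; rewrite !mulrA.
  move=> t; rewrite !big_map /= -!mulr_suml slideb; apply: eq_bigr => p _ /=.
  by rewrite !mulrA.
have move_blank x z1 y w : A x z1 * y * (a * w * b) = a * z1 * b * y * A x w.
  by rewrite !mulrA AS -!(mulrA (a * z1)) -SA !mulrA.
have [z1 nzazb] : exists z1, a * z1 * b <> 0.
  apply: contrapT => H; case: (@Rprime a b) => // t.
  by apply: contrapT => abt; apply: H; exists t.
move=> x x' y; apply/subr0_eq.
have [|//|//] := @Rprime (A x z * y * A x' z - A x' z * y * A x z) (a * z1 * b).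
move=> w; rewrite !mulrBl; apply/eqP; rewrite subr_eq0; apply/eqP.
have H t : A x z1 * t * (A x' z * y * (a * z * b))
           = a * z1 * b * t * (A x z * y * A x' z).
  by rewrite move_blank -(mulrA _ y) (mulrA (A x z1 * t)) move_blank !mulrA.
(* Rotating the product moves the slot of A x z1 from the first place to the last. *)
have := sandwich_transpose H w.
by rewrite -(mulrA _ w) -(mulrA _ (a * z * b)) (mulrA (a * z * b)) -move_blank !mulrA.
Qed.

End PrimeRing.

(** * Multilinear identities *)

Section Words.
Variables (K : fieldType) (Q : algType K).
Implicit Types (x : nat -> Q) (c : seq nat -> K) (w u v t : seq nat) (ws : seq (seq nat)).

Definition wordprod x w : Q := \prod_(i <- w) x i.
Definition wordpoly c ws x : Q := \sum_(w <- ws) c w *: wordprod x w.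

Definition subst1 x i (a : Q) : nat -> Q := fun k => if k == i then a else x k.

Lemma wordprod_subst1 x i a u v : i \notin u -> i \notin v ->
  wordprod (subst1 x i a) (u ++ i :: v) = wordprod x u * a * wordprod x v.
Proof.
move=> iu iv; rewrite /wordprod big_cat big_cons /= {2}/subst1 eqxx mulrA.
by congr (_ * _ * _); apply: eq_big_seq => k; rewrite /subst1;
  case: eqP => // -> ki; rewrite ki in iu iv *.
Qed.

Lemma wordprod_subst1_notin x i a w : i \notin w ->
  wordprod (subst1 x i a) w = wordprod x w.
Proof.
move=> iw; apply: eq_big_seq => k; rewrite /subst1.
by case: eqP => // -> ki; rewrite ki in iw.
Qed.

Lemma split_at_letter i w : uniq w -> i \in w ->
  exists u v, [/\ w = u ++ i :: v, i \notin u & i \notin v].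
Proof.
move=> uw iw; case/splitPr: iw uw => u v; rewrite cat_uniq /= negb_or -!andbA.
by case/and5P=> _ iu _ iv _; exists u, v.
Qed.

Lemma split_at_pair i j w : uniq w -> i \in w -> j \in w ->
    (index i w < index j w)%N ->
  exists u v t, w = u ++ i :: v ++ j :: t.
Proof.
move=> uw /(split_at_letter uw) [u [v [wE iu iv]]] jw.
have uv : uniq v by move: uw; rewrite wE cat_uniq /= => /and4P[].
rewrite wE in jw *.
rewrite !index_cat (negPf iu) /= eqxx addn0.
case: ifPn => [ju|ju ltij]; first by rewrite ltnNge ltnW // index_mem.
have jv : j \in v.
  move: jw; rewrite mem_cat (negPf ju) inE /= => /orP[/eqP ji|//].
  by move: ltij; rewrite ji eqxx addn0 ltnn.
have [v1 [t [-> _ _]]] := split_at_letter uv jv.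
by exists u, v1, t.
Qed.

Lemma index_order_inj w w' : uniq w -> perm_eq w w' ->
  (forall i j, i \in w -> j \in w ->
     (index i w < index j w)%N -> (index i w' < index j w')%N) -> w = w'.
Proof.
elim: w w' => [|a w IHw] w' /=; first by move=> _; rewrite perm_sym => /perm_nilP.
case/andP=> aw uw; case: w' => [/perm_nilP //|b w'] pww' ord.
have ab : a = b.
  have := perm_mem pww' b; rewrite !inE eqxx /= => /orP [/eqP->//|bw].
  have := ord a b; rewrite !inE !eqxx bw orbT /= !eqxx ltn0.
  by case: eqVneq => // _ /(_ isT isT isT).
subst b; move: pww'; rewrite perm_cons => pww'; congr (_ :: _); apply: IHw => // i j iw jw ij.
have := ord i j; rewrite !inE iw jw !orbT /=.
have [ai aj] : a != i /\ a != j.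
  by split; apply: contraNneq aw => ->.
by rewrite (negPf ai) (negPf aj) !ltnS; apply.
Qed.

Lemma wordpoly_split (P : pred (seq nat)) c ws x :
  wordpoly c ws x =
    wordpoly c (filter P ws) x + wordpoly c (filter (predC P) ws) x.
Proof.
by rewrite /wordpoly -big_cat; apply/perm_big; rewrite perm_sym (permEl (perm_filterC _ _)).
Qed.

(** A nonzero polynomial, multilinear in the letters of s, given by its list ws
    of monomials. *)
Definition multilinear c s ws := [/\ uniq s, uniq ws, ws != [::],
  {in ws, forall w, perm_eq w s} & {in ws, forall w, c w != 0}].

Lemma wordprod_subst2 x i j a b u v t : uniq (u ++ i :: v ++ j :: t) ->
  wordprod (subst1 (subst1 x i a) j b) (u ++ i :: v ++ j :: t)
    = wordprod x u * a * wordprod x v * b * wordprod x t.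
Proof.
rewrite -cat_cons catA => uw.
have [ju jt] : j \notin u ++ i :: v /\ j \notin t.
  move: uw; rewrite uniq_catC /= mem_cat negb_or => /andP[/andP[jt ju] _] //.
have [iu iv it] : [/\ i \notin u, i \notin v & i \notin t].
  move: uw; rewrite -catA uniq_catC /= mem_cat !negb_or mem_cat inE !negb_or.
  by case/andP=> /andP[/and3P[]].
by rewrite wordprod_subst1 // wordprod_subst1 // [X in _ * X]wordprod_subst1_notin.
Qed.

Lemma wordpoly_bimulop c s ws i j x : uniq s -> i \in s -> j \in s ->
  {in ws, forall w, perm_eq w s} ->
  {in ws, forall w, index i w < index j w}%N ->
  exists L, forall a b, wordpoly c ws (subst1 (subst1 x i a) j b) = bimulop L a b.
Proof.
move=> us si sj; elim: ws => [|w ws IHws] pws ijws.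
  by exists [::] => a b; rewrite /wordpoly /bimulop !big_nil.
have [w1 ws1|w1 ws1|L HL] := IHws.
  by apply: pws; rewrite inE ws1 orbT.
  by apply: ijws; rewrite inE ws1 orbT.
have pw : perm_eq w s by apply: pws; rewrite mem_head.
have ijw : (index i w < index j w)%N by apply: ijws; rewrite mem_head.
have uw : uniq w by rewrite (perm_uniq pw).
have [||u [v [t wE]]] := split_at_pair uw _ _ ijw; rewrite ?(perm_mem pw) //.
exists (([:: (c w *: wordprod x u, wordprod x v)], wordprod x t) :: L) => a b.
rewrite /wordpoly /bimulop !big_cons -/(bimulop L a b) -HL; congr (_ + _).
by rewrite /mulop big_seq1 /= {2}wE wordprod_subst2 -?wE // -!scalerAl.
Qed.

(** The left factors a_k are the prefixes up to j: they do not involve the value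
    of i, which comes later, and can be chosen before it. *)
Lemma wordpoly_mulop c s ws i j x : uniq s -> i \in s -> j \in s ->
  {in ws, forall w, perm_eq w s} ->
  {in ws, forall w, index j w < index i w}%N ->
  exists as_, forall a, exists2 m, [seq p.1 | p <- m] = as_ &
    forall b, - wordpoly c ws (subst1 (subst1 x i a) j b) = mulop m b.
Proof.
move=> us si sj; elim: ws => [|w ws IHws] pws ijws.
  exists [::] => a; exists [::] => // b.
  by rewrite /wordpoly /mulop !big_nil oppr0.
have [w1 ws1|w1 ws1|as_ Has] := IHws.
  by apply: pws; rewrite inE ws1 orbT.
  by apply: ijws; rewrite inE ws1 orbT.
have pw : perm_eq w s by apply: pws; rewrite mem_head.
have ijw : (index j w < index i w)%N by apply: ijws; rewrite mem_head.
have uw : uniq w by rewrite (perm_uniq pw).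
have [||u [v [t wE]]] := split_at_pair uw _ _ ijw; rewrite ?(perm_mem pw) //.
have ji : j != i by apply: contraTneq ijw => ->; rewrite ltnn.
exists (- (c w *: wordprod x u) :: as_) => a; have [m mas Hm] := Has a.
exists ((- (c w *: wordprod x u), wordprod x v * a * wordprod x t) :: m) => [|b].
  by rewrite /= mas.
rewrite /wordpoly /mulop !big_cons -/(mulop m b) -Hm opprD; congr (_ + _).
have -> : wordprod (subst1 (subst1 x i a) j b) w =
          wordprod (subst1 (subst1 x j b) i a) w.
  apply: eq_bigr => k _; rewrite /subst1; case: eqP => [->|//].
  by rewrite (negPf ji).
by rewrite /= {2}wE wordprod_subst2 -?wE // !mulNr -!scalerAl !mulrA.
Qed.

(** Take two monomials ordering a pair of letters i, j differently, and let A
    be the part of the polynomial where i precedes j; on the other part, the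
    factor in front of j does not involve the value of i.  If A vanishes
    identically, it is a shorter identity; and a single monomial is not an
    identity, as its letters can be set to 1. *)
Lemma identity_bimulop c s ws : multilinear c s ws -> (forall x, wordpoly c ws x = 0) ->
  exists (L : seq (seq (Q * Q) * Q)) as_, nonzero2 (bimulop L) /\
    forall a, exists2 m, [seq p.1 | p <- m] = as_ & bimulop L a =1 mulop m.
Proof.
have [n] := ubnP (size ws); elim: n ws => // n IHn ws.
rewrite ltnS => lt_ws [us uws nzws pws cws] f0.
have [[i [j [si sj [w [w' [ws_w ws_w' ij ji]]]]]]|no_pair] := pselect (exists i j,
    [/\ i \in s, j \in s & exists w w', [/\ w \in ws, w' \in ws,
      (index i w < index j w)%N & (index j w' < index i w')%N]]); last first.
  case: ws lt_ws uws nzws pws cws f0 no_pair => // w [|w' ws] _ uws _ pws cws f0 no_pair.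
    have := f0 (fun=> 1); rewrite /wordpoly big_seq1 /wordprod big1 //.
    by move/eqP; rewrite scaler_eq0 oner_eq0 orbF (negPf (cws w _)) // mem_head.
  have w's : w' \in [:: w, w' & ws] by rewrite !inE eqxx orbT.
  have ws_w : w \in [:: w, w' & ws] by rewrite mem_head.
  have pw := pws _ ws_w; have pw' := pws _ w's.
  have uw : uniq w by rewrite (perm_uniq pw).
  suff ww' : w = w' by move: uws; rewrite /= ww' mem_head.
  apply: index_order_inj => //; first by rewrite (perm_trans pw) // perm_sym.
  move=> i j iw jw ij; rewrite ltnNge leq_eqVlt; apply/negP => /orP[/eqP|] ji.
    have eq_ij : i = j by apply: (@index_inj _ i w'); rewrite ?(perm_mem pw') -?(perm_mem pw).
    by rewrite eq_ij ltnn in ij.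
  by apply: no_pair; exists i, j; split; rewrite -?(perm_mem pw) //; exists w, w'.
pose P w := (index i w < index j w)%N.
have pw' : w' \in filter (predC P) ws by rewrite mem_filter /= /P -leqNgt ltnW.
have neq_ij : i != j by apply: contraTneq ij => ->; rewrite ltnn.
have [f1|/existsNP[x nz]] := pselect (forall x, wordpoly c (filter P ws) x = 0).
  apply: (IHn (filter P ws)) => //.
    apply: leq_trans lt_ws; rewrite -(perm_size (permEl (perm_filterC P ws))) size_cat.
    by rewrite -addn1 leq_add2l; case: (filter _ ws) pw'.
  split=> //; first exact: filter_uniq.
  - by apply/eqP => fP; have : w \in filter P ws; [rewrite mem_filter ws_w andbT | rewrite fP].
  - by move=> v; rewrite mem_filter => /andP[_ /pws].
  - by move=> v; rewrite mem_filter => /andP[_ /cws].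
have [||L HL] := @wordpoly_bimulop c s (filter P ws) i j x us si sj.
- by move=> v; rewrite mem_filter => /andP[_ /pws].
- by move=> v; rewrite mem_filter => /andP[].
have [||as_ Has] := @wordpoly_mulop c s (filter (predC P) ws) i j x us si sj.
- by move=> v; rewrite mem_filter => /andP[_ /pws].
- move=> v; rewrite mem_filter /= /P -leqNgt leq_eqVlt => /andP[/orP[/eqP ijv|//] /pws pv].
  by case/eqP: neq_ij; apply: (@index_inj _ i v) => //; rewrite (perm_mem pv).
exists L, as_; split.
  exists (x i), (x j); rewrite -HL.
  suff -> : subst1 (subst1 x i (x i)) j (x j) = x by [].
  by apply/funext => k; rewrite /subst1; case: eqP => [->//|_]; case: eqP => [->|].
move=> a; have [m mas Hm] := Has a; exists m => // b.
by rewrite -HL -Hm; apply/eqP; rewrite -addr_eq0 -(wordpoly_split P) f0.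
Qed.

Definition in_pideal (p : Q) (x : nat -> Q) := forall i, exists a b, x i = a * p * b.

(** A monomial that does not start with j starts with a letter whose value lies
    in Q p Q, and this letter stands in front of j. *)
Lemma wordpoly_later p c ws s j x z : in_pideal p x -> uniq s -> j \in s ->
  {in ws, forall w, perm_eq w s} -> {in ws, forall w, ohead w != Some j} ->
  exists D : seq (Q * Q * Q), forall y,
    wordpoly c ws (subst1 x j (y * z)) = \sum_(d <- D) d.1.1 * p * d.1.2 * y * d.2.
Proof.
move=> px us sj; elim: ws => [|w ws IHws] pws jws.
  by exists [::] => y; rewrite /wordpoly !big_nil.
have [w1 ws1|w1 ws1|D HD] := IHws.
  by apply: pws; rewrite inE ws1 orbT.
  by apply: jws; rewrite inE ws1 orbT.
have pw : perm_eq w s by apply: pws; rewrite mem_head.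
have uw : uniq w by rewrite (perm_uniq pw).
have jw : j \in w by rewrite (perm_mem pw).
have [u [v [wE ju jv]]] := split_at_letter uw jw.
have := jws _ (mem_head _ _); case: u => [|h u] in wE ju *.
  by rewrite wE /= eqxx.
move=> _; have [a [b xh]] := px h.
exists ((c w *: a, b * wordprod x u, z * wordprod x v) :: D) => y.
rewrite /wordpoly !big_cons -HD; congr (_ + _).
rewrite {2}wE wordprod_subst1 // {1}/wordprod big_cons -/(wordprod x u) xh /=.
by rewrite -!scalerAl !mulrA.
Qed.

Hypothesis Qprime : prime_ring Q.

(** Write the polynomial as j f' + f'', where the monomials of f'' do not start
    with j.  If f' vanishes on Q p Q, it is an identity of smaller degree there;
    otherwise freeze the other letters at elements of Q p Q with f' nonzero and
    let j run over Q p b.  In each monomial of f'' the factor in front of j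
    lies in Q p Q. *)
Lemma identity_pideal p c s ws : p <> 0 -> multilinear c s ws ->
  (forall x, in_pideal p x -> wordpoly c ws x = 0) ->
  exists (e : Q) (D : seq (Q * Q * Q)), e <> 0 /\
    forall y, y * e + \sum_(d <- D) d.1.1 * p * d.1.2 * y * d.2 = 0.
Proof.
move=> nzp; have [n] := ubnP (size s); elim: n s c ws => // n IHn s c ws.
rewrite ltnS => les [us uws nzws pws cws] f0.
case: ws uws nzws pws cws f0 => // -[|j t] ws.
  move=> uws _ pws cws f0.
  have s0 : s = [::] by apply/perm_nilP; rewrite perm_sym; apply: pws; rewrite mem_head.
  case: ws uws pws cws f0 => [|w ws] uws pws cws f0; last first.
    have : perm_eq w s by apply: pws; rewrite !inE eqxx orbT.
    by rewrite s0 => /perm_nilP w0; move: uws; rewrite w0 cons_uniq mem_head.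
  have /f0 : in_pideal p (fun=> p) by move=> _; exists 1, 1; rewrite mul1r mulr1.
  rewrite /wordpoly big_seq1 /wordprod big_nil => /eqP.
  by rewrite scaler_eq0 oner_eq0 orbF (negPf (cws _ (mem_head _ _))).
set ws0 := _ :: ws => uws _ pws cws f0.
have ws0_jt : j :: t \in ws0 by rewrite mem_head.
have sj : j \in s by rewrite -(perm_mem (pws _ ws0_jt)) mem_head.
pose P (w : seq nat) := ohead w == Some j.
pose ws1 := [seq behead w | w <- ws0 & P w].
pose c1 w := c (j :: w).
have ws1E w : w \in ws1 -> j :: w \in ws0.
  by case/mapP=> -[|i v]; rewrite mem_filter => /andP[// /eqP[->] wv ->].
have pws1 : {in ws1, forall w, perm_eq w (rem j s)}.
  move=> w /ws1E/pws pw; rewrite -(perm_cons j) (perm_trans pw) //.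
  exact: perm_to_rem.
have uws1 : uniq ws1.
  rewrite map_inj_in_uniq ?filter_uniq // => -[|i v] [|i' v'] //; rewrite !mem_filter.
  - by case/andP.
  - by move=> _ /andP[].
  by case/andP=> /eqP[->] _ /andP[/eqP[->] _] /= ->.
have [f1|/existsNP[x /not_implyP[px nz]]] :=
    pselect (forall x, in_pideal p x -> wordpoly c1 ws1 x = 0).
  apply: (IHn (rem j s) c1 ws1) => //.
    by rewrite size_rem //; case: (s) sj les.
  split=> //; first exact: rem_uniq.
    apply/eqP => ws10; have : t \in ws1; last by rewrite ws10.
    by apply/mapP; exists (j :: t); rewrite // mem_filter /P /= eqxx.
  by move=> w /ws1E /cws.
(* The letter j must take values in Q p Q as well, whence the substitution of
   y p b for it, with b keeping the coefficient nonzero. *)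
have [b nzb] : exists b, p * b * wordpoly c1 ws1 x <> 0.
  apply: contrapT => H; case: (Qprime (a := p) (b := wordpoly c1 ws1 x)) => // b.
  by apply: contrapT => nb; apply: H; exists b.
have [||D HD] := @wordpoly_later p c (filter (predC P) ws0) s j x (p * b) px us sj.
- by move=> w; rewrite mem_filter => /andP[_ /pws].
- by move=> w; rewrite mem_filter => /andP[].
exists (p * b * wordpoly c1 ws1 x), D; split=> // y; rewrite -HD.
have -> : y * (p * b * wordpoly c1 ws1 x) = wordpoly c (filter P ws0) (subst1 x j (y * (p * b))).
  rewrite mulrA /wordpoly big_map mulr_sumr; apply: eq_big_seq => w.
  rewrite mem_filter => /andP[]; case: w => // i w /eqP[->] jw_s.
  have jw : j \notin w.
    by have := perm_uniq (pws _ jw_s); rewrite us /= => /andP[].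
  have := @wordprod_subst1 x j (y * (p * b)) [::] w; rewrite /= => -> //.
  by rewrite [wordprod x [::]]big_nil mul1r -scalerAr.
rewrite -(wordpoly_split P); apply: f0 => i; rewrite /subst1.
by case: eqP => _; [exists y, b; rewrite mulrA | apply: px].
Qed.

(** Setting a letter j to 0 kills exactly the monomials containing j, so those
    containing j and those avoiding it form two identities. *)
Lemma wordpoly_filter_letters c ws (P : set Q) js : P 0 ->
  (forall x, (forall i, P (x i)) -> wordpoly c ws x = 0) ->
  forall x, (forall i, P (x i)) ->
    wordpoly c (filter (fun w => all (mem w) js) ws) x = 0.
Proof.
move=> P0; elim: js => [|j js IHjs] f0 x Px /=.
  by rewrite filter_predT f0.
have {IHjs} := IHjs f0; set ws' := filter _ ws => f0'.
have -> : filter (fun w => (mem w) j && all (mem w) js) ws = filter (fun w => j \in w) ws'.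
  by rewrite /ws' -filter_predI.
have := f0' x Px; rewrite (wordpoly_split (fun w => j \in w)).
suff -> : wordpoly c (filter (predC (fun w => j \in w)) ws') x = 0 by rewrite addr0.
have := f0' (subst1 x j 0); rewrite (wordpoly_split (fun w => j \in w)) => E.
rewrite -[RHS]E; last by move=> i; rewrite /subst1; case: eqP.
rewrite {2}/wordpoly big1_seq ?add0r.
  rewrite /wordpoly; apply: eq_big_seq => w; rewrite mem_filter => /andP[/= jw _].
  by rewrite wordprod_subst1_notin.
move=> w /andP[_]; rewrite mem_filter => /andP[jw _]; rewrite /wordprod.
by case/splitPr: jw => u v; rewrite big_cat big_cons /= {2}/subst1 eqxx mul0r mulr0 scaler0.
Qed.

(** The monomials of the expansion of w when the letter i is replaced by the
    sum of the letters in pos i. *)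
Definition blowup_word (pos : nat -> seq nat) w : seq (seq nat) :=
  foldr (fun i vs => [seq j :: v | j <- pos i, v <- vs]) [:: [::]] w.

Lemma wordprod_blowup pos x w :
  wordprod (fun i => \sum_(j <- pos i) x j) w
    = \sum_(v <- blowup_word pos w) wordprod x v.
Proof.
elim: w => [|i w IHw] /=; first by rewrite /wordprod big_seq1 !big_nil.
rewrite big_allpairs_dep /wordprod big_cons -/(wordprod _ w) IHw mulr_suml.
apply: eq_bigr => j _; rewrite mulr_sumr; apply: eq_bigr => v _.
by rewrite /wordprod big_cons.
Qed.

Lemma mem_blowup (w0 : seq nat) (w v : seq nat) :
  (v \in blowup_word (fun i => [seq j <- iota 0 (size w0) | nth 0%N w0 j == i]) w)
  = (all (fun j => j < size w0)%N v && (map (nth 0%N w0) v == w)).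
Proof.
elim: w v => [|i w IHw] v /=; first by case: v => //= j v; rewrite andbF.
apply/allpairsPdep/idP => [[j [v' [+ + ->]]]|].
  rewrite mem_filter mem_iota add0n /= IHw => /andP[/eqP-> ->] /andP[-> /eqP->].
  by rewrite eqxx.
case: v => [|j v] //=.
rewrite eqseq_cons => /andP[/andP[jn vn] /andP[ji vw]]; exists j, v; split=> //.
  by rewrite mem_filter mem_iota ji.
by rewrite IHw vn.
Qed.

Lemma uniq_blowup (w0 w : seq nat) :
  uniq (blowup_word (fun i => [seq j <- iota 0 (size w0) | nth 0%N w0 j == i]) w).
Proof.
elim: w => //= i w IHw; apply: allpairs_uniq => //; first by rewrite filter_uniq ?iota_uniq.
by move=> [? ?] [? ?] _ _ /= [-> ->].
Qed.

(** Let w0 be a longest monomial, of length n, and replace each letter i by the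
    sum of new letters y_j over the positions j of i in w0.  Monomials of the
    result have length at most n, so those that contain all of y_0, ...,
    y_(n-1) are multilinear, and y_0 ... y_(n-1) itself occurs with the
    coefficient of w0.  Each expanded monomial determines the monomial it comes
    from, so there is no cancellation. *)
Lemma linearization c ws (P : set Q) : P 0 -> (forall a b, P a -> P b -> P (a + b)) ->
  uniq ws -> ws != [::] -> {in ws, forall w, c w != 0} ->
  (forall x, (forall i, P (x i)) -> wordpoly c ws x = 0) ->
  exists c' s' ws', multilinear c' s' ws' /\
    forall x, (forall i, P (x i)) -> wordpoly c' ws' x = 0.
Proof.
move=> P0 PD uws nzws cws f0.
have [w0 ws0 maxw0] : exists2 w0, w0 \in ws & {in ws, forall w, size w <= size w0}%N.
  elim: (ws) nzws => // w [|w1 ws1] IH _.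
    by exists w => [|w']; rewrite inE // => /eqP->.
  have [//|w0 w0s maxw0] := IH; case: (leqP (size w) (size w0)) => ww0.
    exists w0 => [|w']; first by rewrite inE w0s orbT.
    by rewrite inE => /orP[/eqP->//|/maxw0].
  exists w => [|w']; rewrite inE ?eqxx // => /orP[/eqP->//|/maxw0 w'w0].
  exact: leq_trans (ltnW ww0).
pose n := size w0; pose pos i := [seq j <- iota 0 n | nth 0%N w0 j == i].
pose ws1 := [seq v | w <- ws, v <- blowup_word pos w].
pose c1 v := c (map (nth 0%N w0) v).
have ws1P v : reflect (all (fun j => j < n)%N v /\ map (nth 0%N w0) v \in ws) (v \in ws1).
  apply: (iffP allpairsPdep) => [[w [v' [ww + ->]]]|[vn vws]].
    by rewrite mem_blowup => /andP[-> /eqP->].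
  by exists (map (nth 0%N w0) v), v; split=> //; rewrite mem_blowup vn eqxx.
have f1 x : (forall i, P (x i)) -> wordpoly c1 ws1 x = 0.
  move=> Px; rewrite -[RHS](f0 (fun i => \sum_(j <- pos i) x j)); last first.
    by move=> i; elim/big_ind: _.
  rewrite /wordpoly big_allpairs_dep; apply: eq_big_seq => w ww.
  rewrite wordprod_blowup scaler_sumr; apply: eq_big_seq => v.
  by rewrite mem_blowup => /andP[_ /eqP vw]; rewrite /c1 vw.
exists c1, (iota 0 n), (filter (fun w => all (mem w) (iota 0 n)) ws1).
split; last exact: wordpoly_filter_letters.
split; first exact: iota_uniq.
- rewrite filter_uniq // allpairs_uniq_dep //.
    by move=> w _; apply: uniq_blowup.
  move=> [w v] [w' v'] /allpairsPdep[w1 [v1 [_ + /= [-> ->]]]].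
  rewrite mem_blowup => /andP[_ /eqP<-] /allpairsPdep[w2 [v2 [_ + /= [-> ->]]]].
  by rewrite mem_blowup => /andP[_ /eqP<-] /= ->.
- apply/eqP => ws10; suff: iota 0 n \in [::] by [].
  rewrite -[X in _ \in X]ws10 mem_filter; apply/andP; split; first exact/allP.
  apply/ws1P; split; first by apply/allP => j; rewrite mem_iota.
  by rewrite map_nth_iota0 ?take_size.
- move=> v; rewrite mem_filter => /andP[/allP nv /ws1P[vn vws]].
  have szv : (size v <= size (iota 0 n))%N.
    by rewrite size_iota -(size_map (nth 0%N w0)) maxw0.
  have [_ eqv] := uniq_min_size (iota_uniq 0 n) nv szv.
  apply: uniq_perm; rewrite ?iota_uniq //.
  exact: (leq_size_uniq (iota_uniq 0 n) nv szv).
by move=> v; rewrite mem_filter => /andP[_ /ws1P[_ /cws]].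
Qed.

End Words.

(** * A central-valued elementary operator *)

Section CentralOperator.
Variable R : nzRingType.
Hypothesis Rprime : prime_ring R.

(** Let mu(v) be the scalar of the extended centroid with R(v) = mu(v) p.  The
    relation reads 1 (x) e = - sum_k a'_k p a''_k (x) b_k; applying the functional
    b |-> mu(v b w) to the right factors gives
    sum_k a'_k R(v b_k w) a''_k = - mu(v e w).  The left side is the operator
    sought, and w is chosen so that it is nonzero.  Multiplied by p the equation
    becomes tau(v) s p = - s R(v e w), which makes sense inside the ring. *)
Lemma rank_one_central (r : seq (R * R)) v0 e (D : seq (R * R * R)) :
  rank_one (mulop r) -> mulop r v0 <> 0 -> e <> 0 ->
  (forall y, y * e + \sum_(d <- D) d.1.1 * mulop r v0 * d.1.2 * y * d.2 = 0) ->
  exists h : seq (R * R), (exists v, mulop h v <> 0) /\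
    forall v y, mulop h v * y = y * mulop h v.
Proof.
set p := mulop r v0 => r1 nzp nze rel.
have [v [w nzvw]] : exists v w, mulop r (v * e * w) <> 0.
  apply: contrapT => H; apply: nzp; apply: (mulopT_transpose_eq0 Rprime) => x.
  case: (Rprime (a := e) (b := mulopT r x)) => // w.
  have r0 v : mulop [seq (q.1, e * w * q.2) | q <- r] v = 0.
    apply: contrapT => nz; apply: H; exists v, w; apply: contra_not nz => <-.
    by rewrite /mulop big_map; apply: eq_bigr => q _; rewrite !mulrA.
  have := mulop_transpose_eq0 Rprime r0 x; rewrite /mulopT big_map mulr_sumr => E.
  by rewrite -[RHS]E; apply: eq_bigr => q _; rewrite !mulrA.
pose h := [seq (d.1.1 * q.1, d.2 * w * q.2 * d.1.2) | d <- D, q <- r].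
have hE t : mulop h t = \sum_(d <- D) d.1.1 * mulop r (t * d.2 * w) * d.1.2.
  rewrite /mulop big_allpairs_dep; apply: eq_bigr => d _.
  by rewrite mulr_sumr mulr_suml; apply: eq_bigr => q _; rewrite !mulrA.
have hp t s : mulop h t * s * p = - (s * mulop r (t * e * w)).
  rewrite hE !mulr_suml.
  transitivity (\sum_(d <- D) \sum_(q <- r) d.1.1 * p * d.1.2 * (s * q.1 * t) * d.2 * w * q.2).
    apply: eq_bigr => d _; rewrite -!mulrA (mulrA d.1.2) (mulrA (mulop r _)) r1.
    by rewrite [mulop r (_ * _)]/mulop !mulr_sumr; apply: eq_bigr => q _; rewrite !mulrA.
  rewrite exchange_big /= [mulop r (t * e * w)]/mulop mulr_sumr -sumrN; apply: eq_bigr => q _.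
  rewrite -!mulr_suml -[X in X * w](addKr (s * q.1 * t * e)) rel addr0 !mulNr !mulrA.
  by [].
exists h; split.
  exists v => hv0; apply: nzvw; apply/eqP.
  by rewrite -oppr_eq0 -[X in - X]mul1r -hp hv0 !mul0r.
move=> t y; apply/subr0_eq.
have [|//|//] := Rprime (a := mulop h t * y - y * mulop h t) (b := p).
by move=> s; rewrite !mulrBl -(mulrA _ y) -!(mulrA y) !hp mulrN !mulrA subrr.
Qed.

Lemma bimulop_mulop (L : seq (seq (R * R) * R)) z :
  exists r, mulop r =1 bimulop L ^~ z.
Proof.
exists [seq (q.1, q.2 * z * p.2) | p <- L, q <- p.1] => x.
rewrite /mulop big_allpairs_dep; apply: eq_bigr => p _.
by rewrite !mulr_suml; apply: eq_bigr => q _; rewrite !mulrA.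
Qed.

End CentralOperator.

Lemma identity_central (K : fieldType) (Q : algType K) (c : seq nat -> K) s ws :
  prime_ring Q -> multilinear c s ws ->
  (forall x : nat -> Q, wordpoly c ws x = 0) ->
  exists h : seq (Q * Q), (exists v, mulop h v <> 0) /\
    forall v y, mulop h v * y = y * mulop h v.
Proof.
move=> Qprime mlin f0; have [L0 [as_ [nzL0 finL0]]] := identity_bimulop mlin f0.
have [L1 [a [nzL1 nza slide1]]] := bimulop_isolate_left nzL0 finL0.
have [L [b [nzL nzb slidea slideb]]] := bimulop_isolate_right nzL1 slide1.
have [v [z nzvz]] := nzL.
have r1 := isolated_rank_one Qprime z nza nzb slidea slideb.
have [r rE] := bimulop_mulop L z.
have nzr : mulop r v <> 0 by rewrite rE.
have [e [D [nze rel]]] := identity_pideal Qprime nzr mlin (fun x _ => f0 x).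
by apply: (rank_one_central Qprime _ nzr nze rel) => x x' y; rewrite !rE.
Qed.

Local Open Scope classical_set_scope.

(** * Commutators and Lie ideals of a central simple algebra *)

Section Spans.
Variables (K : fieldType) (V : lmodType K).
Implicit Types S T : set V.

Lemma subspaceN T u : subspace T -> T u -> T (- u).
Proof. by case=> _ _ TZ Tu; rewrite -scaleN1r; apply: TZ. Qed.

Lemma subspaceB T u v : subspace T -> T u -> T v -> T (u - v).
Proof. by move=> sT Tu Tv; case: (sT) => _ TD _; apply: TD => //; apply: subspaceN. Qed.

Lemma subspace_sum T (I : Type) (r : seq I) (F : I -> V) : subspace T ->
  (forall i, T (F i)) -> T (\sum_(i <- r) F i).
Proof. by case=> T0 TD _ TF; elim/big_ind: _. Qed.

Lemma sub_lspan S : S `<=` lspan S.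
Proof.
move=> v Sv; exists 1%N, (fun=> 1), (fun=> v); split=> //.
by rewrite big_ord1 scale1r.
Qed.

Lemma lspan_min S T : subspace T -> S `<=` T -> lspan S `<=` T.
Proof.
move=> sT ST v [n [c [u [Su ->]]]]; apply: subspace_sum => // i.
by case: sT => _ _; apply; apply: ST.
Qed.

Lemma subspace_lspan S : subspace (lspan S).
Proof.
split.
- by exists 0%N, (fun=> 0), (fun=> 0); split=> [[]//|]; rewrite big_ord0.
- move=> _ _ [n [c [u [Su ->]]]] [m [d [v [Sv ->]]]].
  exists (n + m)%N, (fun i => match split i with inl j => c j | inr j => d j end),
    (fun i => match split i with inl j => u j | inr j => v j end); split.
    by move=> i; case: (split i).
  rewrite big_split_ord /=; congr (_ + _); apply: eq_bigr => i _.
    by rewrite -[lshift _ _]/(unsplit (inl i)) unsplitK.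
  by rewrite -[rshift _ _]/(unsplit (inr i)) unsplitK.
- move=> k _ [n [c [u [Su ->]]]]; exists n, (fun i => k * c i), u; split=> //.
  by rewrite scaler_sumr; apply: eq_bigr => i _; rewrite scalerA.
Qed.

End Spans.

Section CentralSimple.
Variables (K : fieldType) (Q : algType K).
Hypothesis Qprime : prime_ring Q.
Hypothesis Qcentral : forall q : Q, (forall y, q * y = y * q) -> exists k : K, q = k%:A.
Variable h : seq (Q * Q).
Hypothesis nzh : exists v, mulop h v <> 0.
Hypothesis hcentral : forall v y, mulop h v * y = y * mulop h v.

Lemma mulop_scalar (v : Q) : exists k : K, mulop h v = k%:A.
Proof. exact: Qcentral. Qed.

Lemma mulopTZ k (x : Q) : mulopT h (k *: x) = k *: mulopT h x.
Proof.
rewrite /mulopT scaler_sumr; apply: eq_bigr => p _.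
by rewrite -scalerAr -scalerAl.
Qed.

Lemma mulopT_nonzero : exists x, mulopT h x <> 0.
Proof.
apply: contrapT => H; case: nzh => v; apply.
apply: (mulopT_transpose_eq0 Qprime) => x.
by apply: contrapT => nz; apply: H; exists x.
Qed.

(** In other words Q is simple: the values of h on Q p Q are scalars, and not
    all of them vanish. *)
Lemma central_simple (p : Q) : p <> 0 -> exists m, mulop m p = 1.
Proof.
move=> nzp.
have [u [w nz]] : exists u w, mulop h (u * p * w) <> 0.
  apply: contrapT => H; have [x nzx] := mulopT_nonzero.
  case: (Qprime (a := p) (b := mulopT h x)) => // w.
  have h0 u : mulop [seq (q.1, p * w * q.2) | q <- h] u = 0.
    apply: contrapT => nz; apply: H; exists u, w; apply: contra_not nz => <-.
    by rewrite /mulop big_map; apply: eq_bigr => q _; rewrite !mulrA.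
  have := mulop_transpose_eq0 Qprime h0 x; rewrite /mulopT big_map mulr_sumr => E.
  by rewrite -[RHS]E; apply: eq_bigr => q _; rewrite !mulrA.
have [k kE] := mulop_scalar (u * p * w).
have nzk : k != 0 by apply/eqP => k0; apply: nz; rewrite kE k0 scale0r.
exists [seq (k^-1 *: (q.1 * u), w * q.2) | q <- h].
rewrite /mulop big_map /=.
transitivity (k^-1 *: mulop h (u * p * w)); last by rewrite kE scalerA mulVf ?scale1r.
rewrite /mulop scaler_sumr; apply: eq_bigr => q _.
by rewrite -!scalerAl !mulrA.
Qed.

(** Transpose, with y fixed, the identity tau(v) y = y tau(v) in v. *)
Lemma mulopTC (x y : Q) : mulopT h (x * y) = mulopT h (y * x).
Proof.
pose s := [seq (q.1, q.2 * y) | q <- h]; pose s' := [seq (y * q.1, q.2) | q <- h].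
have := @mulop_transpose_eq _ Qprime s s'; rewrite /mulop /mulopT => H.
have := H _ x; rewrite !big_map /= => E.
apply/esym; transitivity (\sum_(q <- h) q.2 * y * x * q.1).
  by apply: eq_bigr => q _; rewrite !mulrA.
rewrite {}E; first by apply: eq_bigr => q _; rewrite !mulrA.
move=> v; rewrite !big_map /=; transitivity (mulop h v * y).
  by rewrite mulr_suml; apply: eq_bigr => q _; rewrite !mulrA.
by rewrite hcentral mulr_sumr; apply: eq_bigr => q _; rewrite !mulrA.
Qed.

Lemma commutator_in (x y : Q) : commutator_span Q (x * y - y * x).
Proof. by apply: sub_lspan; exists x, y. Qed.

Lemma mulopT_commutator (x : Q) : commutator_span Q x -> mulopT h x = 0.
Proof.
move: x; apply: lspan_min; last first.
  by move=> _ [a [b ->]] /=; rewrite raddfB /= mulopTC subrr.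
split=> [|u v u0 v0|k v v0] /=; first by rewrite raddf0.
  by rewrite raddfD /= u0 v0 addr0.
by rewrite mulopTZ v0 scaler0.
Qed.

(** x h_i v g_i and v g_i x h_i differ by the commutator of x h_i and v g_i. *)
Lemma mulop_mod_commutators (v x : Q) :
  commutator_span Q (mulop h v * x - v * mulopT h x).
Proof.
rewrite hcentral /mulop /mulopT !mulr_sumr -sumrB.
apply: subspace_sum; first exact: subspace_lspan.
by move=> q; have := commutator_in (x * q.1) (v * q.2); rewrite !mulrA.
Qed.

Lemma mulopT_eq0 x : mulopT h x = 0 -> commutator_span Q x.
Proof.
move=> Tx0; case: nzh => v; have [k kE] := mulop_scalar v.
rewrite kE => nzk; have := mulop_mod_commutators v x.
rewrite Tx0 mulr0 subr0 kE -scalerAl mul1r => Ckx.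
have nzk' : k != 0 by apply/eqP => k0; apply: nzk; rewrite k0 scale0r.
have [_ _ CZ] := subspace_lspan [set c | exists a b : Q, c = a * b - b * a].
by have := CZ k^-1 _ Ckx; rewrite scalerA mulVf ?scale1r.
Qed.

(** T(v T(x)) = tau(v) T(x) because T kills tau(v) x - v T(x); and y is a sum of
    terms a T(x) b since Q is simple. *)
Lemma mulopT_rank_one (x y : Q) : mulopT h x <> 0 ->
  exists k : K, mulopT h y = k *: mulopT h x.
Proof.
move=> nzTx; have [m mE] := central_simple nzTx.
have absorb (v : Q) : exists k : K, mulopT h (v * mulopT h x) = k *: mulopT h x.
  have [k kE] := mulop_scalar v; exists k; apply/esym/subr0_eq.
  have := mulopT_commutator (mulop_mod_commutators v x).
  by rewrite raddfB /= kE -scalerAl mul1r mulopTZ.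
rewrite -[y]mulr1 -mE /mulop mulr_sumr raddf_sum /=.
elim/big_rec: _ => [|q z _ [k ->]]; first by exists 0; rewrite scale0r.
have [k' k'E] := absorb (q.2 * y * q.1).
exists (k' + k); rewrite scalerDl -k'E; congr (_ + _).
by rewrite !mulrA mulopTC !mulrA.
Qed.

Lemma commutator_codim1 (S : set Q) : subspace S -> commutator_span Q `<=` S ->
  S = commutator_span Q \/ S = [set: Q].
Proof.
move=> sS CS; have [SC|] := pselect (S `<=` commutator_span Q).
  by left; apply/seteqP.
move/existsNP => [x /not_implyP[Sx nCx]]; right.
have nzTx : mulopT h x <> 0 by move=> /mulopT_eq0.
apply/seteqP; split=> // y _; have [k kE] := mulopT_rank_one y nzTx.
have [_ SD SZ] := sS; rewrite -(subrK (k *: x) y); apply: SD; last exact: SZ.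
by apply/CS/mulopT_eq0; rewrite raddfB /= mulopTZ kE subrr.
Qed.

Definition lie_ideal (U : set Q) := forall u q : Q, U u -> U (u * q - q * u).

(** With d = [u, .], expanding d (d (x y)) = 0 gives 2 d(x) d(y) = 0, and then
    d(r) s d(r) = d(r) d(s r) - d(r) d(s) r = 0. *)
Lemma double_derivation_central (u : Q) : (2%:R : K) != 0 ->
    (forall r, u * (u * r - r * u) = (u * r - r * u) * u) ->
  forall r, u * r = r * u.
Proof.
move=> nz2; pose d r := u * r - r * u; rewrite -/(d _) => dd r.
have dM x y : d (x * y) = d x * y + x * d y.
  by rewrite /d mulrBl mulrBr !mulrA addrA subrK.
have dD x y : d (x + y) = d x + d y by rewrite /d mulrDr mulrDl opprD addrACA.
have d_d x y : d x * d y = 0.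
  apply/eqP; rewrite -(inj_eq (scalerI nz2)) scaler0.
  have dd0 z : d (d z) = 0 by rewrite {1}/d dd subrr.
  have : d (d (x * y)) = 0 by [].
  rewrite dM dD !dM !dd0 mul0r mulr0 addr0 add0r -mulr2n => dd2.
  by rewrite scaler_nat; apply/eqP.
apply/subr0_eq; rewrite -/(d r).
suff: forall s, d r * s * d r = 0 by case/Qprime.
by move=> s; have := d_d r (s * r); rewrite dM mulrDr !mulrA d_d mul0r add0r.
Qed.

(** Herstein's argument: T = { t | [t, Q] is contained in U } is a subring
    containing U, hence a Lie ideal.  If T contains a nonzero commutator c, it
    contains Q c Q = Q; otherwise u commutes with [u, r] for all u in U. *)
Theorem lie_ideal_dichotomy (U : set Q) : (2%:R : K) != 0 -> subspace U -> lie_ideal U ->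
  U `<=` scalars Q \/ commutator_span Q `<=` U.
Proof.
move=> nz2 sU lU; have [_ UD _] := sU.
pose T t := forall q, U (t * q - q * t).
have UT t : U t -> T t by move=> Ut q; apply: lU.
have TD x y : T x -> T y -> T (x + y).
  by move=> Tx Ty q; rewrite mulrDl mulrDr opprD addrACA; apply: UD.
have TN x : T x -> T (- x).
  by move=> Tx q; rewrite mulNr mulrN -opprD; apply: subspaceN.
have TM x y : T x -> T y -> T (x * y).
  move=> Tx Ty q; have := UD _ _ (Tx (y * q)) (Ty (q * x)).
  by rewrite !mulrA addrA subrK.
have [[a [b [Ta Tb nzc]]]|Tcomm] :=
    pselect (exists a b, [/\ T a, T b & a * b - b * a <> 0]); last first.
  left=> u Uu; suff ucomm r : u * (u * r - r * u) = (u * r - r * u) * u.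
    by have [k ->] := Qcentral (double_derivation_central nz2 ucomm); exists k.
  apply/subr0_eq; apply: contrapT => nz; apply: Tcomm.
  by exists u, (u * r - r * u); split=> //; apply: UT => //; apply: lU.
right; set c := _ - _ in nzc.
have Tcr r : T (c * r).
  have -> : c * r = (a * (b * r) - b * r * a) - b * (a * r - r * a).
    by rewrite mulrBl mulrBr !mulrA opprB addrA subrK.
  exact: TD _ _ (UT _ (Ta _)) (TN _ (TM _ _ Tb (UT _ (Ta _)))).
have Tscr s r : T (s * c * r).
  have -> : s * c * r = c * r * s - (c * r * s - s * (c * r)).
    by rewrite opprB addrC subrK mulrA.
  by apply: (TD _ _ _ (TN _ (UT _ (Tcr r s)))); rewrite -mulrA.
have Tall q : T q.
  have [m mE] := central_simple nzc.
  rewrite -[q]mulr1 -mE /mulop mulr_sumr; elim/big_ind: _ => // [|p _].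
    by rewrite -(mulr0 c).
  by rewrite !mulrA.
by apply: lspan_min => // _ [x [y ->]]; apply: Tall.
Qed.

End CentralSimple.

(** * Transfer to the central closure *)

Section Transfer.
Variables (F : fieldType) (A : assocAlgType F) (K : fieldType) (Q : algType K).
Variable phi : {additive A -> Q}.
Hypothesis cc : central_closure phi.

Let phi_inj : injective phi := cc_inj cc.
Let phiM : forall a b, phi (a ** b) = phi a * phi b := cc_mul cc.

Lemma closure_eq0 a : phi a = 0 -> a = 0.
Proof. by move=> a0; apply: phi_inj; rewrite raddf0. Qed.

Lemma closure_center_unit z : acenter z -> z <> 0 ->
  exists2 k : K, k != 0 & phi z = k%:A.
Proof.
move=> cz nzz; have [k kE] := cc_center cc cz; exists k => //.
by apply/eqP => k0; apply/nzz/closure_eq0; rewrite kE k0 scale0r.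
Qed.

Lemma closure_loc q : exists (k : K) a, k != 0 /\ k *: q = phi a.
Proof.
have [z [a [cz nzz E]]] := cc_loc cc q.
have [k nzk kE] := closure_center_unit cz nzz.
by exists k, a; split=> //; rewrite -E kE -scalerAl mul1r.
Qed.

Lemma amul_scale_center (c : F) (z : A) : acenter z -> acenter (c *: z).
Proof. by move=> cz a; rewrite amulZl amulZr cz. Qed.

(** Multiplication by a scalar of F acts on phi A as a scalar of K, namely the
    quotient phi (c z) / phi z for any nonzero central z. *)
Lemma closure_scale (c : F) :
  exists k : K, (forall a, phi (c *: a) = k *: phi a) /\ (c != 0 -> k != 0).
Proof.
have [z [_ [cz nzz _ _]]] := cc_frac cc 1.
have [k nzk kE] := closure_center_unit cz nzz.
have [k' k'E] := cc_center cc (amul_scale_center c cz).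
exists (k^-1 * k'); split=> [a|nzc].
  apply: (scalerI nzk); rewrite !scalerA mulrA divff // mul1r.
  have -> : k *: phi (c *: a) = phi z * phi (c *: a) by rewrite kE -scalerAl mul1r.
  by rewrite -phiM amulZr -amulZl phiM k'E -scalerAl mul1r.
rewrite mulf_neq0 ?invr_eq0 //; apply/eqP => k'0.
have /closure_eq0/eqP : phi (c *: z) = 0 by rewrite k'E k'0 scale0r.
by rewrite scaler_eq0 (negPf nzc) => /eqP.
Qed.

Lemma closure_char : 2%N \notin [pchar F] -> (2%:R : K) != 0.
Proof.
rewrite inE /= => nz2; have [z [_ [cz nzz _ _]]] := cc_frac cc 1.
apply/eqP => K2; case: nzz; apply/eqP.
have /closure_eq0/eqP : phi (2%:R *: z) = 0.
  by rewrite scaler_nat raddfMn /= -scaler_nat K2 scale0r.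
by rewrite scaler_eq0 (negPf nz2).
Qed.

(** If a A b = 0 then b lies in the ideal J of all y with a A y = 0, and the left
    annihilator I of J contains a z for z central; z cancels. *)
Lemma closure_prime : prime_alg A -> prime_ring Q.
Proof.
move=> Aprime p q pq0.
have [z [_ [cz nzz _ _]]] := cc_frac cc 1.
have [kz nzkz kzE] := closure_center_unit cz nzz.
have z_cancel a : a ** z = 0 -> a = 0.
  move=> az0; apply/closure_eq0/(scalerI nzkz).
  by rewrite scaler0 -[RHS](raddf0 phi) -az0 phiM kzE -scalerAr mulr1.
have [kp [a [nzkp aE]]] := closure_loc p.
have [kq [b [nzkq bE]]] := closure_loc q.
have ab0 x : a ** x ** b = 0.
  by apply: closure_eq0; rewrite !phiM -aE -bE -!scalerAl -scalerAr pq0 !scaler0.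
pose J : set A := [set y | forall x, a ** x ** y = 0].
pose I : set A := [set x | forall y, J y -> x ** y = 0].
have a0x (x : A) : 0 ** x = 0 by rewrite -(scale0r (0 : A)) amulZl !scale0r.
have ax0 (x : A) : x ** 0 = 0 by rewrite -(scale0r (0 : A)) amulZr !scale0r.
have iJ : ideal J.
  split; [split=> [x|u v Ju Jv x|c v Jv x]|move=> x y Jy; split=> t].
  - by rewrite ax0.
  - by rewrite amulDr Ju Jv addr0.
  - by rewrite amulZr Jv scaler0.
  - by rewrite amulA -(amulA a) Jy.
  - by rewrite amulA Jy a0x.
have iI : ideal I.
  split; [split=> [y _|u v Iu Iv y Jy|c v Iv y Jy]|move=> x y Iy; split=> t Jt].
  - by rewrite a0x.
  - by rewrite amulDl Iu // Iv // addr0.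
  - by rewrite amulZl Iv // scaler0.
  - by rewrite -amulA Iy // ax0.
  - by rewrite -amulA Iy //; case: (iJ) => _ /(_ x t Jt) [].
have IJ0 : ideal_prod I J = [set 0].
  apply/seteqP; split; last first.
    by move=> _ ->; case: (subspace_lspan [set c | exists a b, [/\ I a, J b & c = a ** b]]).
  apply: lspan_min => [|_ [x [y [Ix Jy ->]]]]; last exact: Ix.
  by split=> // [u v|c v] ->; [move=> -> /=; rewrite addr0 | rewrite /= scaler0].
have [I0|nzI] := pselect (I = [set 0]).
  left; have : I (a ** z) by move=> y; apply.
  rewrite I0 => /z_cancel a0.
  by apply/(scalerI nzkp); rewrite aE a0 raddf0 scaler0.
have [J0|nzJ] := pselect (J = [set 0]); last by case: (Aprime I J iI iJ nzI nzJ).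
right; have : J b by [].
by rewrite J0 => b0; apply/(scalerI nzkq); rewrite bE b0 raddf0 scaler0.
Qed.

Lemma closure_central_scalar (q : Q) : (forall y, q * y = y * q) -> exists k : K, q = k%:A.
Proof.
move=> cq; have [k [a [nzk aE]]] := closure_loc q.
have [|k' k'E] := @cc_center _ _ _ _ _ cc a.
  by move=> b; apply: phi_inj; rewrite !phiM -aE -scalerAl -scalerAr cq.
by exists (k^-1 * k'); rewrite -scalerA -k'E -aE scalerA mulVf ?scale1r.
Qed.

Lemma closure_word (x : nat -> A) w : w != [::] ->
  phi (word_eval x w) = wordprod (phi \o x) w.
Proof.
case: w => // i w _; rewrite /wordprod /= big_cons.
elim/last_ind: w => [|w j IHw]; first by rewrite big_nil mulr1.
by rewrite foldl_rcons phiM IHw -cats1 big_cat big_seq1 mulrA.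
Qed.

(** Multilinearity is what lets the identity pass from phi A to Q: each element
    of Q is a scalar multiple of an element of phi A. *)
Lemma closure_identity : PI_alg A -> exists (c : seq nat -> K) s ws,
  multilinear c s ws /\ forall x : nat -> Q, wordpoly c ws x = 0.
Proof.
case=> f [nzf f1 f0].
have [iota_ iotaP] := choice closure_scale.
pose c0 (w : seq nat) := iota_ (f@_(FMonom w)).
pose ws0 := [seq fmonom_val w | w <- msupp f].
have memws0 w : (w \in ws0) = (FMonom w \in msupp f).
  apply/mapP/idP => [[[v] vf -> //]|wf]; by exists (FMonom w).
have [||||||c [s [ws [mlin id0]]]] :=
    @linearization K Q c0 ws0 (range phi).
- by exists 0 => //; rewrite raddf0.
- by move=> _ _ [a _ <-] [b _ <-]; exists (a + b) => //; rewrite raddfD.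
- by rewrite map_inj_uniq ?fset_uniq //; apply: val_inj.
- apply: contra nzf => /eqP ws00; rewrite -msupp_eq0; apply/eqP/fsetP => w.
  rewrite inE; have := memws0 (fmonom_val w); rewrite ws00 in_nil; case: w => w /= <- //.
- by move=> w; rewrite memws0 -mcoeff_neq0 => nz; have [_] := iotaP (f@_(FMonom w)); apply.
- move=> x Px; have [y yE] : exists y : nat -> A, x = phi \o y.
    have [y yE] := choice (fun i => let: ex_intro2 a _ e := Px i in ex_intro (fun a => phi a = x i) a e).
    by exists y; apply/funext => i /=; rewrite yE.
  rewrite -[RHS](raddf0 phi) -(f0 y) /ncpoly_eval raddf_sum /wordpoly big_map.
  apply: eq_big_seq => -[w] wf; have [-> _] := iotaP (f@_(FMonom w)).
  rewrite closure_word ?yE //; apply/eqP => w0.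
  by move: wf; rewrite /= in w0 *; rewrite -mcoeff_neq0 w0 -fmoneE f1 eqxx.
exists c, s, ws; split=> // x; have [_ _ _ pws _] := mlin.
have [k kP] := choice (fun i => closure_loc (x i)).
have [y yP] := choice kP.
have nzk : \prod_(i <- s) k i != 0.
  by rewrite prodf_seq_neq0; apply/allP => i _; case: (yP i).
apply: (scalerI nzk); rewrite scaler0 -[RHS](id0 (phi \o y)); last by move=> i; exists (y i).
rewrite /wordpoly scaler_sumr; apply: eq_big_seq => w ww.
rewrite !scalerA mulrC -scalerA; congr (_ *: _); rewrite -(perm_big _ (pws _ ww)) /=.
rewrite /wordprod; elim: (w) => [|i v IHv]; first by rewrite !big_nil scale1r.
rewrite !big_cons -IHv -scalerA; case: (yP i) => _ /= <-.
by rewrite -scalerAr -scalerAl !scalerA mulrC.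
Qed.

Lemma involution_opp (sigma : {rmorphism F -> F}) (star : A -> A) :
  involution_alg sigma star -> {morph star : a / - a}.
Proof.
case=> _ sD _ _ _ a.
have s0 : star 0 = 0 by apply: (addrI (star 0)); rewrite -sD !addr0.
by apply: (addrI (star a)); rewrite -sD !subrr.
Qed.

Lemma center_skew_exists (sigma : {rmorphism F -> F}) (star : A -> A) :
  involution_alg sigma star -> second_kind star ->
  exists s, [/\ acenter s, s <> 0 & star s = - s].
Proof.
move=> inv [z cz nz]; have sN := involution_opp inv.
case: inv => _ sD sM sK _.
exists (z - star z); split.
- move=> a; have -> b : (z - star z) ** b = z ** b - star z ** b.
    by rewrite amulDl -scaleN1r amulZl scaleN1r.
  have -> : a ** (z - star z) = a ** z - a ** star z.
    by rewrite amulDr -[- star z]scaleN1r amulZr scaleN1r.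
  by rewrite cz; congr (_ - _); rewrite -[a]sK -!sM cz.
- by move=> /subr0_eq zz; apply: nz.
by rewrite sD sN sK opprB addrC.
Qed.

(** Brackets with a symmetric x are obtained from the skew element s x, s being
    central, skew and invertible in Q; and 2 a is the sum of a symmetric and a
    skew element. *)
Lemma closure_lie_ideal (sigma : {rmorphism F -> F}) (star : A -> A) (L : set A) :
  2%N \notin [pchar F] -> involution_alg sigma star -> second_kind star ->
  lie_skew_ideal star L -> lie_ideal (closure_span phi L).
Proof.
move=> ch2 inv second [sL lieL] u q.
have nz2 := closure_char ch2.
have [s [cs nzs sskew]] := center_skew_exists inv second.
have [ks nzks ksE] := closure_center_unit cs nzs.
have sS := subspace_lspan (phi @` L); have [S0 SD SZ] := sS.
have sN := involution_opp inv; case: inv => _ sD sM sK _.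
move: u; apply: lspan_min => [|_ [l Ll <-]].
  split=> [|u v Su Sv|c v Sv] /=.
  - by rewrite mul0r mulr0 subrr.
  - by rewrite mulrDl mulrDr opprD addrACA; apply: SD.
  - by rewrite -scalerAl -scalerAr -scalerBr; apply: SZ.
have [k [a [nzk aE]]] := closure_loc q.
have comm_skew x : star x = - x -> closure_span phi L (phi l * phi x - phi x * phi l).
  move=> xskew; apply: sub_lspan; exists (l ** x - x ** l); first exact: lieL.
  by rewrite raddfB /= !phiM.
have comm_sym x : star x = x -> closure_span phi L (phi l * phi x - phi x * phi l).
  move=> xsym; have : star (s ** x) = - (s ** x).
    by rewrite sM xsym sskew -scaleN1r amulZr scaleN1r cs.
  move/comm_skew/(SZ ks^-1); rewrite phiM ksE -scalerAl mul1r -scalerAl -scalerAr -scalerBr.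
  by rewrite scalerA mulVf ?scale1r.
have sym : star (a + star a) = a + star a by rewrite sD sK addrC.
have skew : star (a - star a) = - (a - star a) by rewrite sD sN sK opprB addrC.
have nzk2 : 2%:R * k != 0 by rewrite mulf_neq0.
have := SZ (2%:R * k)^-1 _ (SD _ _ (comm_sym _ sym) (comm_skew _ skew)).
rewrite addrACA -opprD -mulrDr -mulrDl -raddfD addrACA subrr addr0.
have -> : phi (a + a) = (2%:R * k) *: q by rewrite raddfD /= -mulr2n -scaler_nat -aE scalerA.
by rewrite -scalerAr -scalerAl -scalerBr scalerA mulVf // scale1r.
Qed.

End Transfer.

Theorem theorem3p15 (F : fieldType) (A : assocAlgType F)
    (sigma : {rmorphism F -> F}) (star : A -> A) (L : set A)
    (K : fieldType) (Q : algType K) (phi : {additive A -> Q}) :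
  prime_alg A -> PI_alg A ->
  involution_alg sigma star -> second_kind star ->
  lie_skew_ideal star L ->
  central_closure phi ->
  2%N \notin [pchar F] ->
  [\/ closure_span phi L = [set 0],
      closure_span phi L = scalars Q,
      closure_span phi L = commutator_span Q
    | closure_span phi L = [set: Q]].
Proof.
move=> Aprime API inv second skewL cc ch2.
have Qprime := closure_prime cc Aprime.
have Qcentral := closure_central_scalar cc.
have [c [s [ws [mlin f0]]]] := closure_identity cc API.
have [h [nzh hcentral]] := identity_central Qprime mlin f0.
have lieL := closure_lie_ideal cc ch2 inv second skewL.
have sS : subspace (closure_span phi L) := subspace_lspan _.
have [SK|CS] := lie_ideal_dichotomy Qprime Qcentral nzh hcentral (closure_char cc ch2) sS lieL.
  have [S0|] := pselect (closure_span phi L `<=` [set 0]).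
    by constructor 1; apply/seteqP; split=> // _ ->; case: sS.
  move/existsNP => [x /not_implyP[Sx nzx]]; constructor 2; apply/seteqP; split=> // _ [k _ <-].
  have [k' _ xE] := SK _ Sx; have nzk' : k' != 0.
    by apply/eqP => k0; apply: nzx; rewrite /= -xE k0 scale0r.
  have [_ _ SZ] := sS; have := SZ (k / k') _ Sx.
  by rewrite -xE scalerA divfK.
have [SC|ST] := commutator_codim1 Qprime Qcentral nzh hcentral sS CS.
  by constructor 3.
by constructor 4.
Qed.
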